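(* Let $R$ be a Prüfer domain and let $M$ be an $R$-module. Suppose that there exists a countable ascending chain $0 = M_0 \subseteq M_1 \subseteq \dots \subseteq M_n \subseteq \dots$ $(n < \omega)$ of submodules of $M$ such that: (i) every $M_n$ is projective; (ii) every $M_n$ is pure in $M$; (iii) for every $n<\omega$, the factor module $M_{n+1}/M_n$ admits a $G(\aleph_0)$-family $\mathcal{C}_n$ consisting of pure submodules of $M_{n+1}/M_n$; and (iv) $M = \bigcup_{n<\omega} M_n$. Then $M$ is projective.
   Context: A domain is a commutative ring with identity and without zero divisors. A Prüfer domain is a domain in which every finitely generated ideal is projective. A submodule $N$ of an $R$-module $M$ is pure in $M$ if every finite system of equations $\sum_{j=1}^m r_{ij} x_j = a_i$ $(i=1,\dots,n)$, with $r_{ij}\in R$ and $a_i \in N$, is solvable in $N$ whenever it is solvable in $M$. A $G(\aleph_0)$-family of an $R$-module $M$ is a family $\mathcal{B}$ of submodules of $M$ such that: (1) $0, M \in \mathcal{B}$; (2) $\mathcal{B}$ is closed under unions of ascending chains of arbitrary lengths; (3) for every $A_0 \in \mathcal{B}$ and every countable set $H \subseteq M$, there exists $A \in \mathcal{B}$ containing both $A_0$ and $H$ such that $A/A_0$ is countably generated. *)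

(* Defs.v *)
From HB Require Import structures.
From mathcomp Require Import all_boot all_order all_algebra.
From mathcomp Require Import all_classical wochoice.

Set Implicit Arguments.
Unset Strict Implicit.
Unset Printing Implicit Defensive.

Import GRing.Theory.
Local Open Scope classical_set_scope.
Local Open Scope ring_scope.

Record submodule (R : pzRingType) (M : lmodType R) := Submodule {
  submod_set :> set M;
  submodP : submod_closed [in submod_set] }.

Section Submodule.
Context (R : pzRingType) (M : lmodType R) (N : submodule M).

Definition submod_pred : {pred M} := [in (N : set M)].

Fact submod_pred_closed : submod_closed submod_pred.
Proof. exact: submodP. Qed.

HB.instance Definition _ :=
  GRing.isSubmodClosed.Build R M submod_pred submod_pred_closed.

Record submod_type : Type := SubmodElt {
  submod_val : M;
  submod_valP : submod_val \in submod_pred }.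

HB.instance Definition _ := [isSub for submod_val].
HB.instance Definition _ := [Choice of submod_type by <:].
HB.instance Definition _ :=
  [SubChoice_isSubLmodule of submod_type by <:].

(* The library's quotient of an additive group by a subgroup, equipped below
   with the scalar action induced by that of M. *)
Definition factor : Type := Quotient.quot submod_pred.

HB.instance Definition _ := GRing.Zmodule.on factor.

Definition to_factor (x : M) : factor := (\pi_(Quotient.quot submod_pred) x)%qT.

Lemma to_factorP (x y : M) :
  to_factor x = to_factor y <-> (x - y \in submod_pred).
Proof.
by rewrite Quotient.idealrBE; split=> [xy|/eqP //]; apply/eqP.
Qed.

Fact to_factorD : {morph to_factor : x y / x + y}.
Proof. by move=> x y; exact: (raddfD (\pi_(Quotient.quot submod_pred))%qT). Qed.

Definition factor_scale (a : R) (u : factor) : factor :=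
  to_factor (a *: (repr (u : Quotient.quot submod_pred))).

Lemma factor_reprK (u : factor) :
  to_factor (repr (u : Quotient.quot submod_pred)) = u.
Proof. exact: reprK. Qed.

Lemma factor_scaleE a x : factor_scale a (to_factor x) = to_factor (a *: x).
Proof.
apply/to_factorP; rewrite -scalerBr rpredZ //.
by apply/to_factorP; rewrite factor_reprK.
Qed.

Fact factor_scaleA a b v :
  factor_scale a (factor_scale b v) = factor_scale (a * b) v.
Proof. by rewrite -(factor_reprK v) !factor_scaleE scalerA. Qed.

Fact factor_scale1 : left_id 1 factor_scale.
Proof. by move=> v; rewrite -(factor_reprK v) factor_scaleE scale1r. Qed.

Fact factor_scaleDr : right_distributive factor_scale +%R.
Proof.
move=> a u v; rewrite -(factor_reprK u) -(factor_reprK v).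
by rewrite -to_factorD !factor_scaleE scalerDr to_factorD.
Qed.

Fact factor_scaleDl v :
  {morph factor_scale^~ v : a b / a + b}.
Proof.
by move=> a b; rewrite -(factor_reprK v) !factor_scaleE scalerDl to_factorD.
Qed.

HB.instance Definition _ := GRing.Zmodule_isLmodule.Build R factor
  factor_scaleA factor_scale1 factor_scaleDr factor_scaleDl.

Fact to_factor_linear : linear to_factor.
Proof. by move=> a x y; rewrite to_factorD -factor_scaleE. Qed.

HB.instance Definition _ :=
  GRing.isLinear.Build R M factor *:%R to_factor to_factor_linear.

End Submodule.

Section Relative.
Context (R : pzRingType) (M : lmodType R) (P N : submodule M).

Definition trace_set : set (submod_type P) := val @^-1` N.

Fact trace_closed : submod_closed [in trace_set].
Proof.
have [N0 NL] := submodP N.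
split=> [|a x y]; rewrite !inE /trace_set /= ?linear0.
  by rewrite inE in N0.
by move=> Nx Ny; have := NL a (val x) (val y); rewrite !inE; apply.
Qed.

Definition trace := Submodule trace_closed.

(* This is P / N when N is contained in P (in general, P / (P :&: N)). *)
Definition relfactor : lmodType R := factor trace.

End Relative.

Section Notions.
Context (R : pzRingType).
Implicit Types (M : lmodType R).

Definition span M (S : set M) : set M :=
  smallest (fun A : set M => submod_closed [in A]) S.

Definition finitely_generated M : Prop :=
  exists S : set M, finite_set S /\ span S = setT.

Definition countably_generated M : Prop :=
  exists S : set M, countable S /\ span S = setT.

Definition projective M : Prop :=
  forall (A B : lmodType R) (g : {linear A -> B}) (f : {linear M -> B}),
    (forall b, exists a, g a = b) ->
    exists h : {linear M -> A}, forall x, g (h x) = f x.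

Definition pure M (N : submodule M) : Prop :=
  forall (n m : nat) (r : 'M[R]_(n, m)) (a : 'I_n -> M),
    (forall i, submod_set N (a i)) ->
    (exists x : 'I_m -> M, forall i, \sum_j r i j *: x j = a i) ->
    exists x : 'I_m -> M,
      (forall j, submod_set N (x j)) /\ forall i, \sum_j r i j *: x j = a i.

(* An ascending chain of arbitrary length is a nondecreasing family indexed by
   a well-ordered type; the empty chain is excluded because its union is not a
   submodule. *)
Definition G_aleph0_family M (B : set (submodule M)) : Prop :=
  [/\ (exists2 A, B A & A = [set 0] :> set M) /\
      (exists2 A, B A & A = setT :> set M),
      forall (I : eqType) (le : rel I) (C : I -> submodule M) (U : submodule M),
        well_order le ->
        (forall i j, le i j -> C i `<=` C j) ->
        (forall i, B (C i)) ->
        U = \bigcup_i C i :> set M ->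
        B U &
      forall (A0 : submodule M) (H : set M), B A0 -> countable H ->
        exists A : submodule M,
          [/\ B A, A0 `<=` A, H `<=` A & countably_generated (relfactor A A0)]].

End Notions.

Definition prufer_domain (R : idomainType) : Prop :=
  forall I : submodule R^o,
    finitely_generated (submod_type I) -> projective (submod_type I).

(* Main.v *)
Require Import Defs.
From HB Require Import structures.
From mathcomp Require Import all_boot all_order all_algebra.
From mathcomp Require Import all_classical wochoice.

(* Over a Pruefer domain a finitely generated torsion-free module is projective:
   split off the torsion closure of one generator, which is isomorphic to a
   finitely generated ideal. Suppose that M / A is the union of a chain of
   projective submodules with torsion-free factors. Then finitely generated
   submodules of M / A have finitely generated torsion closures, so that any
   countably generated A' / A with M / A' torsion-free is the union of a countable
   chain whose factors are projective.

   Fix a dual basis of every M_n. Call A good if, for all n, it contains the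
   basis elements supporting each element of A /\ M_n, and the image of A in
   M_{n+1} / M_n belongs to C_n. Good submodules have quotients M / A as above and
   are closed under unions of chains. A countable closing-off argument embeds
   every good A <> M into a larger good A' with A' / A countably generated, so
   that liftings along surjections extend from A to A'; Zorn's lemma then
   produces a lifting defined on all of M. *)

Set Implicit Arguments.
Unset Strict Implicit.
Unset Printing Implicit Defensive.

Import GRing.Theory.
Local Open Scope classical_set_scope.
Local Open Scope ring_scope.

Local Notation span := Defs.span.

(** * Submodules as sets *)

Lemma nondecreasing_subset (T : Type) (F : nat -> set T) :
  (forall k, F k `<=` F k.+1) -> forall i j, (i <= j)%N -> F i `<=` F j.
Proof.
by move=> FS i j /subnK <-; elim: (j - i)%N => //= n IH x /IH; exact: FS.
Qed.

Section Submod.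
Context (R : pzRingType) (M : lmodType R).
Implicit Types (A B S : set M) (x y : M).

Definition submod A : Prop :=
  A 0 /\ forall a x y, A x -> A y -> A (a *: x + y).

Lemma submodE A : submod A <-> submod_closed [in A].
Proof.
split=> -[A0 AL]; split=> [|a x y]; rewrite ?inE //.
- exact: AL.
- by move: A0; rewrite inE.
by move=> Ax Ay; have := AL a x y; rewrite !inE; apply.
Qed.

Lemma submod_submodule (N : submodule M) : submod N.
Proof. by apply/submodE; exact: submodP. Qed.

Lemma submodule_of A : submod A -> exists N : submodule M, N = A :> set M.
Proof. by move=> /submodE cA; exists (Submodule cA). Qed.

Lemma submod0 A : submod A -> A 0. Proof. by case. Qed.

Lemma submodD A x y : submod A -> A x -> A y -> A (x + y).
Proof. by move=> -[_ AL] Ax Ay; have := AL 1 x y Ax Ay; rewrite scale1r. Qed.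

Lemma submodZ A a x : submod A -> A x -> A (a *: x).
Proof. by move=> -[A0 AL] Ax; have := AL a x 0 Ax A0; rewrite addr0. Qed.

Lemma submodN A x : submod A -> A x -> A (- x).
Proof. by move=> sA Ax; rewrite -scaleN1r; exact: submodZ. Qed.

Lemma submodB A x y : submod A -> A x -> A y -> A (x - y).
Proof. by move=> sA Ax Ay; apply: submodD => //; exact: submodN. Qed.

Lemma submod_sum A (I : eqType) (r : seq I) (F : I -> M) :
  submod A -> (forall i, i \in r -> A (F i)) -> A (\sum_(i <- r) F i).
Proof.
move=> sA AF; rewrite big_seq; apply: (big_ind A) => //.
- exact: submod0.
- by move=> x y; exact: submodD.
Qed.

Lemma submodI A B : submod A -> submod B -> submod (A `&` B).
Proof.
by move=> [A0 AL] [B0 BL]; split=> // a x y [Ax Bx] [Ay By]; split; auto.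
Qed.

Lemma submod_span S : submod (span S).
Proof.
split=> [A [/(submodE A).2 sA _]|a x y Sx Sy A cA]; first exact: submod0.
have /(submodE A).2 sA := cA.1.
by case: sA => _; apply; [apply: Sx|apply: Sy].
Qed.

Lemma sub_span S : S `<=` span S.
Proof. by move=> x Sx A [_]; apply. Qed.

Lemma span_min S A : submod A -> S `<=` A -> span S `<=` A.
Proof. by move=> /submodE sA SA; exact: smallest_sub. Qed.

Lemma span_mono S S' : S `<=` S' -> span S `<=` span S'.
Proof.
by move=> SS'; apply: span_min => [|x /SS' ?]; [exact: submod_span|exact: sub_span].
Qed.

Lemma span_id A : submod A -> span A = A.
Proof. by move=> sA; apply/seteqP; split; [exact: span_min|exact: sub_span]. Qed.

Lemma span_addP A S x : submod A ->
  span (A `|` S) x <-> exists2 a, A a & span S (x - a).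
Proof.
move=> sA; split; last first.
  move=> [a Aa Sxa]; rewrite -(subrK a x); apply: (submodD (submod_span _)).
  - by move: Sxa; apply: span_mono => y; right.
  - by apply: sub_span; left.
move: x; apply: span_min.
  split; first by exists 0; [exact: submod0|rewrite subrr; exact: (submod0 (submod_span _))].
  move=> a x y [b Ab Sb] [c Ac Sc]; exists (a *: b + c).
    by case: sA => _; apply.
  rewrite opprD addrACA -scalerBr.
  by case: (submod_span S) => _; apply.
move=> x [Ax|Sx]; first by exists x; rewrite // subrr; exact: (submod0 (submod_span _)).
by exists 0; [exact: submod0|rewrite subr0; exact: sub_span].
Qed.

Lemma span_bigcup (S : nat -> set M) : (forall k, S k `<=` S k.+1) ->
  span (\bigcup_k S k) = \bigcup_k span (S k).
Proof.
move=> Sinc.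
have Smono := nondecreasing_subset Sinc.
apply/seteqP; split; last first.
  by move=> x [k _]; apply: span_mono => y Sy; exists k.
apply: span_min.
  split; first by exists 0%N => //; exact: (submod0 (submod_span _)).
  move=> a x y [i _ Sx] [j _ Sy]; exists (maxn i j) => //.
  case: (submod_span (S (maxn i j))) => _; apply.
    by move: Sx; apply: span_mono; apply: Smono; rewrite leq_maxl.
  by move: Sy; apply: span_mono; apply: Smono; rewrite leq_maxr.
by move=> x [k _ Sx]; exists k => //; exact: sub_span.
Qed.

(** Each element of [s] can be changed by an element of [A] so as to land in [N]; this does not
    alter the span over [A]. *)
Lemma span_representatives A N (s : seq M) : submod A -> submod N ->
  (forall x, x \in s -> span (A `|` N) x) ->
  exists2 t : seq M, (forall x, x \in t -> N x) &
    span (A `|` [set` s]) `<=` span (A `|` [set` t]).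
Proof.
move=> sA sN; elim: s => [|x s IH] sAN; first by exists [::].
have [|t Nt st] := IH; first by move=> y sy; apply: sAN; rewrite inE sy orbT.
have [a Aa] : exists2 a, A a & N (x - a).
  have /(span_addP _ _ sA)[a Aa] := sAN x (mem_head _ _).
  by rewrite span_id //; exists a.
move=> Nxa; exists (x - a :: t).
  by move=> y; rewrite inE => /predU1P[->//|/Nt].
have tt' : span (A `|` [set` t]) `<=` span (A `|` [set` x - a :: t]).
  apply: (span_mono (S := A `|` _)) => y [Ay|ty]; [by left|right].
  by rewrite /= in_cons ty orbT.
apply: (span_min (submod_span _)).
move=> y [Ay|]; first by apply: sub_span; left.
rewrite /= inE => /predU1P[->|sy]; last first.
  by have /st/tt' : span (A `|` [set` s]) y by apply: sub_span; right.
suff : span (A `|` [set` x - a :: t]) (x - a + a) by rewrite subrK.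
apply: (submodD (submod_span _)); apply: sub_span; [right|by left].
exact: mem_head.
Qed.

End Submod.

Section SubmodType.
Context (R : pzRingType) (M : lmodType R) (N : submodule M).

Lemma submod_type_in (y : submod_type N) : submod_set N (val y).
Proof. by case: y => x /=; rewrite inE. Qed.

Lemma in_submod_type (x : M) : submod_set N x ->
  exists y : submod_type N, val y = x.
Proof. by move=> Nx; exists (SubmodElt (mem_set Nx : x \in submod_pred N)). Qed.

End SubmodType.

Section LinearOf.
Context (R : pzRingType) (U V : lmodType R) (f : U -> V) (lf : linear f).

(* The vacuous let makes lf a parameter, from which the instance is inferred. *)
Definition linear_of := let _ := lf in f.

Fact linear_of_linear : linear linear_of. Proof. exact: lf. Qed.

HB.instance Definition _ :=
  GRing.isLinear.Build R U V *:%R linear_of linear_of_linear.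

End LinearOf.

Section LinOn.
Context (R : pzRingType) (M X : lmodType R).

(** A partial linear map is a total function whose values off [A] are arbitrary, which avoids maps
    between varying subtypes. *)
Definition lin_on (A : set M) (h : M -> X) : Prop :=
  forall a x y, A x -> A y -> h (a *: x + y) = a *: h x + h y.

Lemma lin_on0 A h : submod A -> lin_on A h -> h 0 = 0.
Proof.
move=> [A0 _] lh; have := lh 1 0 0 A0 A0.
by rewrite !scale1r addr0 => /(congr1 (fun z => z - h 0)); rewrite subrr addrK.
Qed.

End LinOn.

(* Holds as soon as A is contained in B and B / A is projective. *)
Definition lin_ext (R : pzRingType) (M : lmodType R) (A B : set M) : Prop :=
  forall (X Y : lmodType R) (g : {linear X -> Y}) (f : {linear M -> Y})
    (h : M -> X),
    (forall y, exists x, g x = y) ->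
    lin_on A h -> (forall x, A x -> g (h x) = f x) ->
    exists h' : M -> X,
      [/\ lin_on B h', forall x, B x -> g (h' x) = f x &
          forall x, A x -> h' x = h x].

(** * Extension of liftings *)

Section LinExt.
Context (R : pzRingType) (M : lmodType R).
Implicit Types (A B F : set M).

Lemma lin_ext_trans A B F : A `<=` B -> lin_ext A B -> lin_ext B F -> lin_ext A F.
Proof.
move=> AB eAB eBF X Y g f h gsurj lh gh.
have [h1 [lh1 gh1 h1h]] := eAB X Y g f h gsurj lh gh.
have [h2 [lh2 gh2 h2h1]] := eBF X Y g f h1 gsurj lh1 gh1.
by exists h2; split=> // x Ax; rewrite h2h1 ?h1h//; exact: AB.
Qed.

Lemma lin_ext_bigcup (F : nat -> set M) : (forall k, F k `<=` F k.+1) ->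
  (forall k, submod (F k)) -> (forall k, lin_ext (F k) (F k.+1)) -> lin_ext (F 0%N) (\bigcup_k F k).
Proof.
move=> Finc sF Fext X Y g f h gsurj lh gh.
pose good k (u : M -> X) := lin_on (F k) u /\ forall x, F k x -> g (u x) = f x.
(* Nothing is asked of [step] on inputs that are not [good], so it can be a total function. *)
have /choice[step stepP] (ku : nat * (M -> X)) : exists u : M -> X,
    good ku.1 ku.2 ->
    good ku.1.+1 u /\ forall x, F ku.1 x -> u x = ku.2 x.
  case: ku => k u /=; have [gu|ngu] := pselect (good k u); last by exists u.
  have [u' [? ? ?]] := Fext k X Y g f u gsurj gu.1 gu.2.
  by exists u'.
pose fix hs k := if k is k'.+1 then step (k', hs k') else h.
have hsP k : good k (hs k).
  by elim: k => [//|k IH]; exact: (stepP (k, hs k) IH).1.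
have hsS k x : F k x -> hs k.+1 x = hs k x.
  exact: (stepP (k, hs k) (hsP k)).2.
have Fmono := nondecreasing_subset Finc.
have hs_mono i j x : (i <= j)%N -> F i x -> hs j x = hs i x.
  move=> /subnK <- Fx; elim: (j - i)%N => //= n IH.
  rewrite -IH -/(hs (n + i).+1) hsS //.
  by apply: Fmono Fx; rewrite leq_addl.
(* The glued map reads x at a stage [idx x] containing it; by [hs_mono] the choice of stage is
   immaterial. *)
have /choice[idx idxP] (x : M) : exists i, (\bigcup_k F k) x -> F i x.
  have [[k _ Fx]|] := pselect ((\bigcup_k F k) x); first by exists k.
  by exists 0%N.
have hsE k x : F k x -> hs (idx x) x = hs k x.
  move=> Fx; have Fix : F (idx x) x by apply: idxP; exists k.
  by have [le|/ltnW le] := leqP (idx x) k; [symmetry|]; exact: hs_mono.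
exists (fun x => hs (idx x) x); split.
- move=> a x y [i _ Fx] [j _ Fy].
  have {}Fx : F (maxn i j) x by apply: Fmono Fx; rewrite leq_maxl.
  have {}Fy : F (maxn i j) y by apply: Fmono Fy; rewrite leq_maxr.
  rewrite (hsE _ _ Fx) (hsE _ _ Fy).
  rewrite (hsE (maxn i j)); last by case: (sF (maxn i j)) => _; apply.
  by have [lk _] := hsP (maxn i j); exact: lk.
- by move=> x [k _ Fx]; rewrite (hsE _ _ Fx); apply: (hsP k).2.
- by move=> x Fx; exact: (hsE 0%N).
Qed.

(** Zorn's lemma applies to graphs of partial liftings with domain in [B]; a maximal graph with
    proper domain could be extended by the last hypothesis. *)
Lemma lin_ext_projective (B : set (set M)) :
  (forall A, B A -> submod A) -> B [set 0] ->
  (forall F : set (set M), F `<=` B -> F !=set0 -> total_on F subset ->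
    B (\bigcup_(A in F) A)) ->
  (forall A, B A -> A <> setT ->
    exists A', [/\ B A', A `<=` A', A' <> A & lin_ext A A']) ->
  projective M.
Proof.
move=> Bsub B0 Bchain Bext X Y g f gsurj.
pose good (G : set (M * X)) :=
  [/\ B (fst @` G), forall x y y', G (x, y) -> G (x, y') -> y = y',
      forall a u v, G u -> G v -> G (a *: u.1 + v.1, a *: u.2 + v.2) &
      forall u, G u -> g u.2 = f u.1].
have [|G [PG Gmax]] := @Zorn_bigcup _ (fun G => G = set0 \/ good G).
  move=> F FP Ftot; have [[G0 FG0 G0n]|noF] := pselect (exists2 G, F G & G !=set0).
    right; have goodF G u : F G -> G u -> good G.
      by move=> /FP[->|].
    have pair u v : (\bigcup_(G in F) G) u -> (\bigcup_(G in F) G) v ->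
        exists G, [/\ F G, G u & G v].
      move=> [G1 F1 G1u] [G2 F2 G2v]; have [G12|G21] := Ftot _ _ F1 F2.
        by exists G2; split=> //; exact: G12.
      by exists G1; split=> //; exact: G21.
    split.
    - have -> : fst @` (\bigcup_(G in F) G) =
          \bigcup_(A in (fun G => fst @` G) @` (F `&` [set G | G !=set0])) A.
        apply/seteqP; split=> [x [u [G FG Gu] <-]|x [_ [G [FG _] <-] [u Gu <-]]].
          exists (fst @` G); last by exists u.
          by exists G => //; split=> //; exists u.
        by exists u => //; exists G.
      apply: Bchain.
      + by move=> _ [G [FG [u Gu]] <-]; case: (goodF G u FG Gu).
      + by exists (fst @` G0); exists G0.
      + move=> _ _ [G [FG _] <-] [G' [FG' _] <-].
        by have [s|s] := Ftot _ _ FG FG'; [left|right]; exact: image_subset.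
    - move=> x y y' Ux Uy; have [G [FG Gu Gv]] := pair _ _ Ux Uy.
      by have [_ fG _ _] := goodF _ _ FG Gu; exact: fG Gu Gv.
    - move=> a u v Uu Uv; have [G [FG Gu Gv]] := pair _ _ Uu Uv.
      by have [_ _ lG _] := goodF _ _ FG Gu; exists G => //; exact: lG.
    - by move=> u [G FG Gu]; have [_ _ _ ] := goodF _ _ FG Gu; apply.
  left; apply/seteqP; split=> // u [G FG Gu]; apply: noF.
  by exists G => //; exists u.
have gG : good G.
  case: PG => // G0; exfalso; apply: (Gmax [set (0, 0)]).
    by rewrite G0; split=> // /(_ (0, 0)); apply.
  right; split.
  - by rewrite image_set1.
  - by move=> x y y' => -[_ ->] [_ ->].
  - by move=> a _ _ -> -> /=; rewrite !scaler0 !addr0.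
  - by move=> _ -> /=; rewrite !linear0.
have [BG fG lG gfG] := gG.
have /choice[h0 h0P] (x : M) : exists y, (fst @` G) x -> G (x, y).
  have [[[x' y] Gxy /= <-]|] := pselect ((fst @` G) x); first by exists y.
  by exists 0.
have lh0 : lin_on (fst @` G) h0.
  move=> a x y Ax Ay; apply: (fG (a *: x + y)).
    apply: h0P; have [_ ] := Bsub _ BG; exact.
  exact: (lG a (x, _) (y, _) (h0P _ Ax) (h0P _ Ay)).
have gh0 x : (fst @` G) x -> g (h0 x) = f x.
  by move=> /h0P /gfG.
have [GT|GnT] := pselect (fst @` G = setT).
  have lh : linear h0 by move=> a x y; apply: lh0; rewrite GT.
  by exists (linear_of lh) => x; apply: gh0; rewrite GT.
have [A' [BA' AA' A'A eAA']] := Bext _ BG GnT.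
have [h1 [lh1 gh1 h1h]] := eAA' X Y g f h0 gsurj lh0 gh0.
(* The graph of [h1] on [A'] contradicts maximality: were it contained in [G], then [A'] would lie
   in the domain of [G]. *)
exfalso; apply: (Gmax [set u | A' u.1 /\ u.2 = h1 u.1]).
  split=> [[x y] Gxy|sub].
    have Ax : (fst @` G) x by exists (x, y).
    by split=> /=; [exact: AA'|rewrite h1h //; apply: (fG x) => //; exact: h0P].
  apply: A'A; apply/seteqP; split=> // x A'x.
  by exists (x, h1 x) => //; apply: sub.
right; split.
- rewrite (_ : fst @` _ = A') //; apply/seteqP.
  by split=> [_ [u [A'u _] <-] //|x A'x]; exists (x, h1 x).
- by move=> x y y' /= [_ ->] [_ ->].
- move=> a u v [Au ->] [Av ->] /=; split; last by rewrite lh1.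
  by case: (Bsub _ BA') => _; apply.
- by move=> [x y] [/= Ax ->]; exact: gh1.
Qed.

(* The section of theta splits F off B. *)
Lemma lin_ext_quotient F B (P : lmodType R) (theta : M -> P) :
  submod B -> F `<=` B -> lin_on B theta ->
  (forall x, B x -> theta x = 0 -> F x) -> (forall x, F x -> theta x = 0) ->
  (forall p, exists2 x, B x & theta x = p) -> projective P -> lin_ext F B.
Proof.
move=> sB FB lt tF Ft tsurj projP X Y g f h gsurj lh gh.
have [B' eB'] := submodule_of sB.
have BB (y : submod_type B') : B (val y) by rewrite -eB'; exact: submod_type_in.
have lt' : linear (fun y : submod_type B' => theta (val y)).
  by move=> a x y; rewrite linearP; exact: lt (BB x) (BB y).
(* Lifting the identity of [P] along the restriction of [theta] to [B] gives a linear section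
   [s]. *)
have [p|s sP] := projP _ _ (linear_of lt') (linear_of (fun a x y => erefl (a *: x + y))).
  have [x Bx <-] := tsurj p; rewrite -eB' in Bx.
  by have [y <-] := in_submod_type Bx; exists y.
have {}sP p : theta (val (s p)) = p := sP p.
have lfs : linear (fun p => f (val (s p))) by move=> a p q; rewrite !linearP.
have [k kP] := projP _ _ g (linear_of lfs) gsurj.
have Fs x : B x -> F (x - val (s (theta x))).
  move=> Bx; apply: tF; first by apply: submodB.
  have := lt (-1) _ _ (BB (s (theta x))) Bx.
  by rewrite !scaleN1r addrC => ->; rewrite sP addNr.
(* The component of x in [F] is treated by [h], the component in the image of [s] by the lifting [k]
   of f composed with [s]. *)
exists (fun x => h (x - val (s (theta x))) + k (theta x)); split.
- move=> a x y Bx By.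
  have -> : a *: x + y - val (s (theta (a *: x + y))) =
      a *: (x - val (s (theta x))) + (y - val (s (theta y))).
    by rewrite lt // linearP [X in _ - X]linearP opprD addrACA scalerBr.
  rewrite (lh _ _ _ (Fs _ Bx) (Fs _ By)) lt // linearP scalerDr.
  by rewrite addrACA.
- move=> x Bx; rewrite linearD gh; last exact: Fs.
  by rewrite kP linearB /linear_of subrK.
- by move=> x Fx; rewrite Ft // (linear0 s) (linear0 k) [X in _ - X]linear0 subr0 addr0.
Qed.

End LinExt.

(** * Finitely generated torsion-free extensions *)

Section Retract.
Context (R : pzRingType) (M : lmodType R).
Implicit Types (A B K : set M).

Lemma lin_ext_refl A : lin_ext A A.
Proof. by move=> X Y g f h _ lh gh; exists h. Qed.

(** With the zero module ['rV[R]_0] as target the lifting conditions become void, so that the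
    identity of [K] extends to [B]. *)
Lemma lin_ext_retract K B : submod K -> lin_ext K B ->
  exists p : M -> M,
    [/\ lin_on B p, forall x, B x -> K (p x) & forall x, K x -> p x = x].
Proof.
move=> sK eKB; have [K' eK'] := submodule_of sK.
have l0 (X : lmodType R) : linear (fun _ : X => 0 : 'rV[R]_0).
  by move=> a x y; rewrite scaler0 addr0.
pose h x : submod_type K' := insubd 0 x.
have vh x : K x -> val (h x) = x.
  by rewrite -eK' => Kx; rewrite /h insubdK ?inE //; exact: mem_set.
have [|a x y Kx Ky|//|h' [lh' _ h'h]] :=
  eKB _ _ (linear_of (l0 (submod_type K'))) (linear_of (l0 M)) h.
- by move=> y; exists 0; apply/matrixP => i [].
- apply: val_inj; rewrite [RHS]linearP /= !vh //.
  by case: sK => _; apply.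
exists (fun x => val (h' x)); split.
- by move=> a x y Bx By; rewrite lh' // linearP.
- by move=> x _; rewrite -eK'; exact: submod_type_in.
- by move=> x Kx; rewrite h'h // vh.
Qed.

(** A retraction of the span onto [K] fixes [A], so it carries the generators [s] over [A] to
    generators of [K] over [A]. *)
Lemma lin_ext_fg A K (s : seq M) : submod A -> submod K -> A `<=` K ->
  K `<=` span (A `|` [set` s]) -> lin_ext K (span (A `|` [set` s])) ->
  exists t : seq M, K = span (A `|` [set` t]).
Proof.
move=> sA sK AK KB eKB; have [p [lp pK pid]] := lin_ext_retract sK eKB.
exists [seq p x | x <- s].
set B := span _ in KB eKB lp pK.
apply/seteqP; split; last first.
  apply: span_min => // x [/AK //|] /= /mapP[y sy ->].
  by apply: pK; apply: sub_span; right.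
move=> x Kx; rewrite -(pid _ Kx); set S := span _.
(* The intersection with [B] is needed because [p] is linear on [B] only. *)
suff : B `<=` B `&` [set x | S (p x)] by move=> /(_ x (KB _ Kx))[].
have sB : submod B := submod_span _; have sS : submod S := submod_span _.
apply: span_min; first split.
- split; first exact: submod0.
  by rewrite /= (lin_on0 sB lp); exact: submod0.
- move=> a y z [By Sy] [Bz Sz]; split; first by case: sB => _; apply.
  by rewrite /= lp //; case: sS => _; apply.
move=> y [Ay|sy].
  split; first by apply: sub_span; left.
  by rewrite /= (pid _ (AK _ Ay)); apply: sub_span; left.
split; first by apply: sub_span; right.
by apply: sub_span; right; apply/mapP; exists y.
Qed.

End Retract.

(** * Torsion closures and the use of the Pruefer hypothesis *)

Section TorsionFree.
Context (R : idomainType) (M : lmodType R).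
Implicit Types (A B F K S : set M).

(** For [A] inside [B], this is torsion-freeness of B / A. *)
Definition rel_torsion_free B A : Prop :=
  forall (r : R) x, r != 0 -> B x -> A (r *: x) -> A x.

(** The preimage in [M] of the torsion submodule of M / [span S]. *)
Definition torsion_closure S : set M :=
  [set x | exists2 r : R, r != 0 & span S (r *: x)].

Lemma submod_torsion_closure S : submod (torsion_closure S).
Proof.
split=> [|a x y [r r0 Sx] [t t0 Sy]].
  by exists 1; rewrite ?oner_eq0 // scaler0; exact: (submod0 (submod_span _)).
exists (t * r); first by rewrite mulf_neq0.
have -> : (t * r) *: (a *: x + y) = (t * a) *: (r *: x) + r *: (t *: y).
  by rewrite scalerDr !scalerA mulrAC (mulrC r t).
case: (submod_span S) => _; apply => //.
exact: (submodZ (A := span S) _ (submod_span S)).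
Qed.

Lemma sub_torsion_closure S : span S `<=` torsion_closure S.
Proof. by move=> x Sx; exists 1; rewrite ?oner_eq0 // scale1r. Qed.

Lemma torsion_closure_torsion_free S : rel_torsion_free setT (torsion_closure S).
Proof.
move=> r x r0 _ [t t0 Sx]; exists (t * r); first by rewrite mulf_neq0.
by rewrite -scalerA.
Qed.

Lemma torsion_closure_min S K : submod K -> rel_torsion_free setT K ->
  S `<=` K -> torsion_closure S `<=` K.
Proof. by move=> sK tK SK x [r r0] /(span_min sK SK); exact: tK. Qed.

Lemma torsion_closure_mono S S' : S `<=` S' ->
  torsion_closure S `<=` torsion_closure S'.
Proof. by move=> SS' x [r r0 Sx]; exists r => //; exact: (span_mono SS'). Qed.

Context (prufR : prufer_domain R).

(* Clearing denominators embeds K / F as a finitely generated ideal of R. *)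
Lemma rank_one_lin_ext F K q (s : seq M) : submod F -> F `<=` K -> K q ->
  rel_torsion_free K F -> K `<=` torsion_closure (F `|` [set q]) ->
  K = span (F `|` [set` s]) -> lin_ext F K.
Proof.
move=> sF FK Kq tKF Kcl eK; have sK : submod K by rewrite eK; exact: submod_span.
(* If q lies in [F], then K / F is both torsion and torsion-free, hence zero. *)
have [Fq|nFq] := pselect (F q).
  suff -> : K = F by exact: lin_ext_refl.
  apply/seteqP; split=> // x Kx; have [r r0 Fx] := Kcl _ Kx.
  by apply: (tKF r) => //; apply: (span_min sF) Fx => y [|->].
have Kden x : K x -> exists2 r : R, r != 0 & exists c : R, F (r *: x - c *: q).
  move=> /Kcl[r r0 /(span_addP _ _ sF)[a Fa]] Sxa; exists r => //.
  suff : span [set q] `<=` [set y | exists c : R, y = c *: q].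
    move=> /(_ _ Sxa)[c ec]; exists c.
    by rewrite -ec opprB addrC subrK.
  apply: span_min => [|_ ->]; last by exists 1; rewrite scale1r.
  split=> [|a' _ _ [c ->] [c' ->]]; first by exists 0; rewrite scale0r.
  by exists (a' * c + c'); rewrite scalerDl scalerA.
(* The product of denominators of the generators [s] is a denominator for all of [K]. *)
have [d d0 dP] : exists2 d : R, d != 0 & forall x, K x -> exists c : R, F (d *: x - c *: q).
  have [d d0 ds] : exists2 d : R, d != 0 &
      forall x, x \in s -> exists c : R, F (d *: x - c *: q).
    have : {subset s <= K} by move=> x sx; apply/mem_set; rewrite eK; apply: sub_span; right.
    elim: (s) => [|x t IH] tK; first by exists 1; rewrite ?oner_eq0.
    have [|d d0 dt] := IH; first by move=> y ty; apply: tK; rewrite inE ty orbT.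
    have [r r0 [c Fc]] := Kden _ (set_mem (tK _ (mem_head _ _))).
    exists (d * r); first by rewrite mulf_neq0.
    move=> y; rewrite inE => /predU1P[->|ty].
      by exists (d * c); rewrite -!scalerA -scalerBr; exact: submodZ.
    have [c' Fc'] := dt _ ty; exists (r * c').
    by rewrite mulrC -!scalerA -scalerBr; exact: submodZ.
  exists d => //; rewrite eK; apply: span_min.
    split=> [|a x y [c Fc] [c' Fc']].
      by exists 0; rewrite scaler0 scale0r subrr; exact: submod0.
    exists (a * c + c').
    have -> : d *: (a *: x + y) - (a * c + c') *: q =
        a *: (d *: x - c *: q) + (d *: y - c' *: q).
      rewrite scalerDr scalerDl opprD addrACA !scalerBr !scalerA.
      by rewrite (mulrC d).
    by case: sF => _; apply.
  move=> x [Fx|/ds //]; exists 0; rewrite scale0r subr0; exact: submodZ.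
(* Modulo [F], x is the fraction [th x] / d times q; the numerator is unique because q is not
   torsion modulo [F]. *)
have /choice[th thP] (x : M) : exists c : R, K x -> F (d *: x - c *: q).
  by have [/dP[c ?]|] := pselect (K x); [exists c|exists 0].
have Fcq (c : R) : F (c *: q) -> c = 0.
  by move=> Fcq; apply: contrapT => /eqP c0; apply: nFq; exact: (tKF c).
have thE x c : K x -> F (d *: x - c *: q) -> th x = c.
  move=> Kx Fc; apply/eqP; rewrite -subr_eq0; apply/eqP/Fcq.
  have := submodB sF Fc (thP _ Kx).
  by rewrite opprB addrC addrA subrK -scalerBl.
have lth : lin_on K (th : M -> R^o).
  move=> a x y Kx Ky; apply: thE; first by case: sK => _; apply.
  rewrite scalerDr scalerDl opprD addrACA scalerA mulrC -!scalerA -scalerBr.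
  by case: sF => _; apply => //; exact: thP.
have th0F x : K x -> th x = 0 -> F x.
  by move=> Kx th0; have := thP _ Kx; rewrite th0 scale0r subr0; exact: tKF.
have Fth0 x : F x -> th x = 0.
  by move=> Fx; apply: thE; [exact: FK|rewrite scale0r subr0; exact: submodZ].
have sI : submod ((th : M -> R^o) @` K).
  split=> [|a _ _ [x Kx <-] [y Ky <-]].
    by exists 0; [exact: submod0|exact: Fth0 (submod0 sF)].
  by exists (a *: x + y); [case: sK => _; apply|exact: lth].
have [I eI] := submodule_of sI.
pose th' x : submod_type I := insubd 0 (th x : R^o).
have vth' x : K x -> val (th' x) = th x.
  move=> Kx; rewrite /th' insubdK //; apply/mem_set; rewrite eI.
  by exists x.
have lth' : lin_on K th'.
  move=> a x y Kx Ky; apply: val_inj; rewrite [RHS]linearP /= !vth' //; first exact: lth.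
  by case: sK => _; apply.
have th'surj p : exists2 x, K x & th' x = p.
  have : submod_set I (val p) := submod_type_in p.
  by rewrite eI => -[x Kx xp]; exists x => //; apply: val_inj; rewrite vth'.
(* On [K] the map [th'] has kernel [F] and image the ideal [I], which the images of [s] generate. *)
apply: (lin_ext_quotient (theta := th')) => //.
- by move=> x Kx e0; apply: th0F => //; rewrite -vth' // e0.
- by move=> x Fx; apply: val_inj; rewrite vth' ?Fth0 //; exact: FK.
apply: prufR; exists [set` [seq th' x | x <- s]]; split; first exact: finite_seq.
apply/seteqP; split=> // p _; have [x Kx <-] := th'surj p.
set S := span _.
suff : K `<=` K `&` [set x | S (th' x)] by move=> /(_ x Kx)[].
have sS : submod S := submod_span _.
rewrite {1}eK; apply: span_min; first split.
- by split; [exact: submod0|rewrite /= (lin_on0 sK lth'); exact: submod0].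
- move=> a y z [Ky Sy] [Kz Sz]; split; first by case: sK => _; apply.
  by rewrite /= lth' //; case: sS => _; apply.
move=> y [Fy|sy].
  split; first exact: FK.
  rewrite /=; have -> : th' y = 0 by apply: val_inj; rewrite vth' ?Fth0 //; exact: FK.
  exact: submod0.
split; first by rewrite eK; apply: sub_span; right.
by apply: sub_span; apply/mapP; exists y.
Qed.

(* Induction on the number of generators: the torsion closure of the first one
   is a retract, hence finitely generated, and has rank at most one. *)
Lemma fg_torsion_free_lin_ext F (s : seq M) : submod F ->
  rel_torsion_free (span (F `|` [set` s])) F ->
  lin_ext F (span (F `|` [set` s])).
Proof.
elim: s F => [|q s IH] F sF tF.
  rewrite (_ : _ `|` _ = F) ?span_id //; first exact: lin_ext_refl.
  by apply/seteqP; split=> x; [case|left].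
set B := span _ in tF *; have sB : submod B := submod_span _.
have FB : F `<=` B by move=> x Fx; apply: sub_span; left.
have Bq : B q by apply: sub_span; right; exact: mem_head.
have sB' : [set` s] `<=` B.
  by move=> x sx; apply: sub_span; right; rewrite /= inE sx orbT.
pose K := B `&` torsion_closure (F `|` [set q]).
have sK : submod K by apply: submodI => //; exact: submod_torsion_closure.
have FK : F `<=` K.
  move=> x Fx; split; first exact: FB.
  by apply: sub_torsion_closure; apply: sub_span; left.
have Kq : K q by split=> //; apply: sub_torsion_closure; apply: sub_span; right.
have eB : B = span (K `|` [set` s]).
  apply/seteqP; split; last by apply: span_min => // x [[]|/sB'].
  apply: span_min => [|x [Fx|]]; first exact: submod_span.
    by apply: sub_span; left; exact: FK.
  rewrite /= inE => /predU1P[->|sx]; apply: sub_span; [by left|by right].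
(* B / K is torsion-free and generated by [s], so the induction hypothesis applies with [K] in place
   of [F]. *)
have eKB : lin_ext K B.
  rewrite eB; apply: IH => // r x r0; rewrite -eB => Bx [_ Kx]; split=> //.
  exact: (torsion_closure_torsion_free r0).
have [t eK] : exists t : seq M, K = span (F `|` [set` t]).
  by apply: (lin_ext_fg (s := q :: s)) => // x [].
apply: (lin_ext_trans FK) eKB.
apply: (rank_one_lin_ext (q := q) (s := t)) => //; last by move=> x [].
by move=> r x r0 [Bx _]; exact: tF.
Qed.

End TorsionFree.

(** * Dual bases, chains and closing off *)

Section DualBasis.
Context (R : pzRingType) (P : lmodType R).

Let F : lmodType R := P -> R^o.

(** A model of the free module on the set [P]: each element of [P] indexes a basis vector, which
    [ev] sends to that element. *)
Let finsupp : set F := [set f | exists s : seq P, forall i, i \notin s -> f i = 0].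

Let ev (f : F) : P := \sum_(i \in [set: P]) (f i : R) *: i.

Let evE (f : F) (s : seq P) : uniq s -> (forall i, i \notin s -> f i = 0) ->
  ev f = \sum_(i <- s) (f i : R) *: i.
Proof.
move=> us fs; rewrite /ev (fsbigE s) //; last by move=> i _ /fs ->; rewrite scale0r.
by under eq_bigl do rewrite in_setT.
Qed.

Let submod_finsupp : submod finsupp.
Proof.
split=> [|a f g [s fs] [t gt]]; first by exists [::].
exists (s ++ t) => i; rewrite mem_cat negb_or => /andP[/fs fi /gt gi].
by rewrite [LHS](_ : _ = a *: f i + g i) // fi gi scaler0 addr0.
Qed.

Let ev_lin : lin_on finsupp ev.
Proof.
move=> a f g [s fs] [t gt].
have fu i : i \notin undup (s ++ t) -> f i = 0.
  by rewrite mem_undup mem_cat negb_or => /andP[/fs].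
have gu i : i \notin undup (s ++ t) -> g i = 0.
  by rewrite mem_undup mem_cat negb_or => /andP[_ /gt].
have fgu i : i \notin undup (s ++ t) -> (a *: f + g) i = 0.
  by move=> iu; rewrite [LHS](_ : _ = a *: f i + g i) // fu // gu // scaler0 addr0.
rewrite !(evE (undup_uniq (s ++ t))) // scaler_sumr -big_split /=.
by apply: eq_bigr => i _; rewrite scalerA -scalerDl.
Qed.

(** The functionals are the coordinates of a linear section of [ev], so every element of [P] is its
    own index. *)
Lemma dual_basis : projective P -> exists phi : P -> P -> R,
  (forall i, linear (phi i : P -> R^o)) /\
  forall x, exists s : seq P,
    (forall i, i \notin s -> phi i x = 0) /\ x = \sum_(i <- s) phi i x *: i.
Proof.
move=> projP; have [N eN] := submodule_of submod_finsupp.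
have Nf (y : submod_type N) : finsupp (val y) by rewrite -eN; exact: submod_type_in.
have lg : linear (fun y : submod_type N => ev (val y)).
  by move=> a x y; rewrite linearP; exact: ev_lin (Nf x) (Nf y).
have [x|h hP] := projP _ _ (linear_of lg) (linear_of (fun a x y => erefl (a *: x + y))).
  pose d : F := fun i => if i == x then 1 else 0.
  have d0 i : i \notin [:: x] -> d i = 0 by rewrite inE /d => /negPf ->.
  have : submod_set N d by rewrite eN; exists [:: x].
  move=> /in_submod_type[y yd]; exists y.
  rewrite [LHS](_ : _ = ev (val y)) // yd (evE (s := [:: x])) // big_seq1 /d eqxx.
  exact: scale1r.
exists (fun i x => val (h x) i); split=> [i a x y|x].
  by rewrite linearP [val _]linearP.
have [s hs] := Nf (h x).
have us i : i \notin undup s -> val (h x) i = 0 by rewrite mem_undup => /hs.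
by exists (undup s); split=> //; rewrite -(evE (undup_uniq s)) //; exact/esym/hP.
Qed.

End DualBasis.

(** * Unions of chains *)

Section Chains.
Context (R : pzRingType) (M : lmodType R).

Lemma submod_bigcup_total (F : set (set M)) : (forall A, F A -> submod A) ->
  F !=set0 -> total_on F subset -> submod (\bigcup_(A in F) A).
Proof.
move=> sF [A FA] Ftot; split=> [|a x y [B FB Bx] [D FD Dy]].
  by exists A => //; exact: submod0 (sF _ FA).
have [BD|DB] := Ftot _ _ FB FD.
  by exists D => //; case: (sF _ FD) => _; apply => //; exact: BD.
by exists B => //; case: (sF _ FB) => _; apply => //; exact: DB.
Qed.

(* With respect to a well-order of the powerset, the members of a chain that
   contain all earlier members form a cofinal well-ordered subchain. *)
Lemma G_family_chain (B : set (submodule M)) (F : set (set M)) :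
  G_aleph0_family B ->
  (forall A, F A -> exists2 N, B N & N = A :> set M) ->
  F !=set0 -> total_on F subset ->
  exists2 U, B U & U = \bigcup_(A in F) A :> set M.
Proof.
move=> [_ Bchain _] FB F0 Ftot.
have [U eU] : exists U : submodule M, U = \bigcup_(A in F) A :> set M.
  apply: submodule_of; apply: submod_bigcup_total => // A /FB[N _ <-].
  exact: submod_submodule.
exists U => //.
have [le lewo] := well_ordering_principle (set M).
have le_refl : reflexive le.
  by move=> A; apply: (wo_chain_reflexive (C := predT)) => // D _; exact: lewo.
have le_anti : antisymmetric le.
  move=> A D; apply: (wo_chain_antisymmetric (C := predT)) => // G _; exact: lewo.
pose record A := F A /\ forall A', F A' -> le A' A -> A' `<=` A.
pose I := {A : set M | `[< record A >]}.
have recI (i : I) : record (val i) by apply/asboolP; exact: valP i.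
have /choice[C CP] (i : I) : exists N : submodule M, B N /\ N = val i :> set M.
  by have [N BN eN] := FB _ (recI i).1; exists N.
apply: (Bchain I (fun i j => le (val i) (val j)) C U).
(* A nonempty part of [I] inherits the least element of its image in the well-ordered powerset. *)
- move=> X [i0 Xi0].
  pose X' : {pred set M} := fun A => `[< exists2 i, i \in X & val i = A >].
  have X'i i : i \in X -> val i \in X' by move=> Xi; apply/asboolP; exists i.
  have [|_ [[/asboolP[z Xz <-] zmin] _]] := lewo X'.
    by exists (val i0); exact: X'i.
  have lez j : j \in X -> le (val z) (val j) by move=> /X'i /zmin.
  exists z; split; first by split.
  move=> j [Xj jmin]; apply/val_inj/le_anti.
  by rewrite lez //; exact: jmin.
- move=> i j leij; rewrite (CP i).2 (CP j).2.
  by apply: (recI j).2 => //; exact: (recI i).1.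
- by move=> i; exact: (CP i).1.
rewrite eU; apply/seteqP; split; last first.
  by move=> x [i _]; rewrite (CP i).2 => ix; exists (val i) => //; exact: (recI i).1.
move=> x [A FA Ax].
(* The least member [A0] of the chain containing [A] is a record: an earlier member lies in [A], or
   contains [A] and then equals [A0]. *)
have [|A0 [[/asboolP[FA0 AA0] A0min] _]] :=
  lewo (fun A' => `[< F A' /\ A `<=` A' >]).
  by exists A; apply/asboolP; split.
have rA0 : `[< record A0 >].
  apply/asboolP; split=> // A' FA' leA'.
  have [A'A|AA'] := Ftot _ _ FA' FA; first by move=> y /A'A /AA0.
  have -> // : A' = A0.
  by apply: le_anti; rewrite leA' A0min //; apply/asboolP.
exists (exist _ A0 rA0 : I) => //; rewrite (CP _).2 /=; exact: AA0.
Qed.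

End Chains.

Lemma countable_bigcup_seq (T : eqType) (H : set T) : countable H ->
  exists E : nat -> seq T,
    (forall k, [set` E k] `<=` [set` E k.+1]) /\ H = \bigcup_k [set` E k].
Proof.
move=> /pfcard_geP[->|[f]].
  by exists (fun=> [::]); split=> //; apply/seteqP; split=> x // [].
exists (fun k => [seq f i | i <- iota 0 k]); split.
  move=> k x /mapP[i]; rewrite mem_iota => /andP[_ ik] ->.
  by apply/mapP; exists i => //; rewrite mem_iota; exact: leqW.
apply/seteqP; split=> [x|x [k _ /mapP[i _ ->]]]; last exact: funS.
move=> /(@surj _ _ _ _ f)[i _ <-]; exists i.+1 => //.
by apply/mapP; exists i; rewrite // mem_iota add0n /=.
Qed.

(** * Closed unbounded classes of countable sets *)

Section Club.
Context (T : Type).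
Implicit Types (P : set (set T)) (H : set T).

Definition unbounded P : Prop :=
  forall H, countable H -> exists H', [/\ countable H', H `<=` H' & P H'].

(** The property is assumed at cofinally many stages only, since an interleaved construction
    enforces each single condition no more often. *)
Definition omega_closed P : Prop :=
  forall H : nat -> set T, (forall k, H k `<=` H k.+1) ->
    (forall m, exists2 k, (m <= k)%N & P (H k)) -> P (\bigcup_k H k).

Definition club P : Prop := unbounded P /\ omega_closed P.

(* At step k enforce the condition of index logn 2 k, an index taking every
   value infinitely often. *)
Lemma club_forall (P : nat -> set (set T)) :
  (forall n, club (P n)) -> club [set H | forall n, P n H].
Proof.
move=> cP; split=> [H cH|H Hinc HP n]; last first.
  by apply: (cP n).2 => // m; have [k mk Pk] := HP m; exists k.
have /choice[step stepP] (nH : nat * set T) : exists H', countable nH.2 ->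
    [/\ countable H', nH.2 `<=` H' & P nH.1 H'].
  case: nH => n G /=; have [cG|] := pselect (countable G); last by exists G.
  by have [G' ?] := (cP n).1 G cG; exists G'.
pose fix Hs k := if k is k'.+1 then step (logn 2 k', Hs k') else H.
have cHs k : countable (Hs k).
  by elim: k => //= k IH; case: (stepP (logn 2 k, Hs k) IH).
have Hinc k : Hs k `<=` Hs k.+1 by case: (stepP (logn 2 k, Hs k) (cHs k)).
exists (\bigcup_k Hs k); split.
- by apply: bigcup_countable => // k _.
- by move=> x Hx; exists 0%N.
move=> n; apply: (cP n).2 => // m.
(* This index before its successor is at least m and has 2-adic valuation n; the successor appears
   because step k produces the set of index k + 1. *)
exists (2 ^ n * m.*2.+1).+1.
  apply: leqW; apply: (leq_trans _ (leq_pmull _ _)); last by rewrite expn_gt0.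
  by rewrite -addnn -addnS leq_addr.
rewrite [Hs _]/=; set k := (2 ^ n * _)%N.
have <- : logn 2 k = n.
  rewrite /k lognM ?expn_gt0 // pfactorK // [X in (_ + X)%N]lognE /= dvdn2 /= odd_double.
  by rewrite addn0.
by case: (stepP (logn 2 k, Hs k) (cHs k)).
Qed.

Lemma club_and P Q : club P -> club Q -> club (P `&` Q).
Proof.
move=> cP cQ.
have := @club_forall (fun n => if n is 0%N then P else Q) _.
rewrite (_ : mkset _ = P `&` Q); first by apply; case.
by apply/seteqP; split=> H => [PQ|[PH QH] []//]; split; [exact: (PQ 0%N)|exact: (PQ 1%N)].
Qed.

End Club.

(** * Good submodules *)

(** The purity condition for one equation in one unknown. *)
Lemma pure_divisible (R : pzRingType) (M : lmodType R) (N : submodule M)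
    (r : R) (x : M) :
  pure N -> submod_set N (r *: x) -> exists2 y, submod_set N y & r *: y = r *: x.
Proof.
move=> pN Nrx.
have [||y [Ny ey]] := pN 1%N 1%N (const_mx r) (fun=> r *: x) => //.
  by exists (fun=> x) => i; rewrite big_ord1 mxE.
by exists (y ord0) => //; have := ey ord0; rewrite big_ord1 mxE.
Qed.

Lemma setU_bigcup_nat (T : Type) (A : set T) (H : nat -> set T) :
  A `|` \bigcup_k H k = \bigcup_k (A `|` H k).
Proof.
apply/seteqP; split=> [x [Ax|[k _ Hx]]|x [k _ [Ax|Hx]]].
- by exists 0%N => //; left.
- by exists k => //; right.
- by left.
- by right; exists k.
Qed.

Section Spans.
Context (R : pzRingType) (M : lmodType R).
Implicit Types (A N S T : set M).

(** The modular law: as [T] lies in [N], the component in [A] of an element of [N] lies in [N]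
    too. *)
Lemma span_capture A N T x : submod A -> submod N -> T `<=` N ->
  span (A `|` T) x -> N x -> span ((A `|` T) `&` N) x.
Proof.
move=> sA sN TN /(span_addP _ _ sA)[a Aa STxa] Nx.
have Na : N a.
  by rewrite -[a](subKr x); apply: submodB => //; exact: (span_min sN TN).
rewrite -(subrK a x); apply: (submodD (submod_span _)); last first.
  by apply: sub_span; split=> //; left.
by move: STxa; apply: span_mono => y Ty; split; [right|exact: TN].
Qed.

Lemma relfactor_generators (C C0 : submodule M) :
  countably_generated (relfactor C C0) ->
  exists S : set M, [/\ countable S, S `<=` C & C `<=` span (C0 `|` S)].
Proof.
move=> [S [cS eS]].
pose rep (u : relfactor C C0) : submod_type C :=
  repr (u : Quotient.quot (submod_pred (trace C C0))).
have repK u : to_factor (trace C C0) (rep u) = u := factor_reprK u.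
exists ((fun u => val (rep u)) @` S); split.
- exact: (sub_countable (card_image_le _ _)).
- by move=> _ [u _ <-]; exact: submod_type_in.
set B := span _; have sB : submod B := submod_span _.
have BE (y z : submod_type C) :
    to_factor (trace C C0) y = to_factor (trace C C0) z -> B (val z) -> B (val y).
  move=> /to_factorP; rewrite inE => C0yz Bz.
  rewrite -(subrK z y) linearD; apply: (submodD sB) => //.
  by apply: sub_span; left.
(* By [BE] one representative in [B] forces all of them into [B]; the classes with this property
   form a submodule, which will contain [S]. *)
have sW : submod [set u : relfactor C C0 |
    forall y : submod_type C, to_factor (trace C C0) y = u -> B (val y)].
  split=> [|a u v Wu Wv] y yu.
    apply: (BE y 0); last by rewrite linear0; exact: submod0.
    by rewrite yu; exact/esym/(linear0 (@to_factor _ _ (trace C C0))).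
  apply: (BE y (a *: rep u + rep v)); first by rewrite to_factor_linear !repK.
  by rewrite linearP; case: sB => _; apply; [exact: Wu|exact: Wv].
move=> x Cx; have [y yx] := in_submod_type Cx; rewrite -yx.
suff : [set: relfactor C C0] `<=` [set u | forall y : submod_type C,
    to_factor (trace C C0) y = u -> B (val y)].
  by move=> /(_ (to_factor (trace C C0) y) I); apply.
rewrite -eS; apply: span_min => // u Su z zu.
apply: (BE z (rep u)); first by rewrite repK.
by apply: sub_span; right; exists u.
Qed.

End Spans.

(** * Torsion-freeness and finite generation over good submodules *)

Section PureChain.
Context (R : idomainType) (M : lmodType R) (Mn : nat -> submodule M).
Context (prufR : prufer_domain R).
Context (Mn0 : Mn 0%N = [set 0] :> set M).
Context (MnS : forall n, Mn n `<=` Mn n.+1).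
Context (MnT : \bigcup_n Mn n = [set: M]).
Context (Mn_pure : forall n, pure (Mn n)).
Context (phi : forall n, submod_type (Mn n) -> submod_type (Mn n) -> R).
Context (phi_lin : forall n i, linear (phi i : submod_type (Mn n) -> R^o)).
Context (phiP : forall n (x : submod_type (Mn n)),
  exists s : seq (submod_type (Mn n)),
    (forall i, i \notin s -> phi i x = 0) /\ x = \sum_(i <- s) phi i x *: i).
Context (fam : forall n, set (submodule (relfactor (Mn n.+1) (Mn n)))).
Context (famG : forall n, G_aleph0_family (@fam n)).
Context (fam_pure : forall n C, fam C -> pure (C : submodule (relfactor (Mn n.+1) (Mn n)))).

Let Mn_mono i j : (i <= j)%N -> Mn i `<=` Mn j.
Proof. exact: (@nondecreasing_subset _ (fun n => Mn n : set M)). Qed.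

Let Mn_cover x : exists n, submod_set (Mn n) x.
Proof.
have : [set: M] x by [].
by rewrite -MnT => -[n _ Mx]; exists n.
Qed.

Let sMn n : submod (Mn n) := submod_submodule (Mn n).

Let phi0 n (i : submod_type (Mn n)) : phi i 0 = 0.
Proof. exact: (linear0 (linear_of (phi_lin i))). Qed.

Let phiL n (i : submod_type (Mn n)) a x y :
  phi i (a *: x + y) = a * phi i x + phi i y.
Proof. exact: phi_lin. Qed.

Let phiZ n (i : submod_type (Mn n)) a x : phi i (a *: x) = a * phi i x.
Proof. by have := phiL i a x 0; rewrite phi0 !addr0. Qed.

Lemma support_in n (y : submod_type (Mn n)) (S : set M) : submod S ->
  (forall i, phi i y != 0 -> S (val i)) -> S (val y).
Proof.
move=> sS yS; have [s [_ ->]] := phiP y.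
rewrite raddf_sum; apply: submod_sum => // i _ /=.
have [->|/yS Si] := eqVneq (phi i y) 0; last exact: submodZ.
by rewrite scale0r; exact: submod0.
Qed.

(** Phrased on [M] through the unique preimage in [Mn n], so that inclusions of spans can be checked
    on generators. *)
Definition supported n (S : set M) : set M :=
  [set w | exists w' : submod_type (Mn n),
    val w' = w /\ forall i, phi i w' != 0 -> S (val i)].

Lemma submod_supported n S : submod (supported n S).
Proof.
split=> [|a _ _ [x [<- xS]] [y [<- yS]]].
  by exists 0; split=> [|i]; [rewrite linear0|rewrite phi0 eqxx].
exists (a *: x + y); split=> [|i]; first by rewrite linearP.
rewrite phiL; have [->|/yS //] := eqVneq (phi i y) 0.
by rewrite addr0 mulf_eq0 negb_or => /andP[_ /xS].
Qed.

Lemma supportedP n S (x : submod_type (Mn n)) :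
  supported n S (val x) -> forall i, phi i x != 0 -> S (val i).
Proof. by move=> [y [/val_inj ->]]. Qed.

Lemma finite_support (s : seq M) n : exists t : seq M,
  forall x : submod_type (Mn n), val x \in s ->
    forall i, phi i x != 0 -> val i \in t.
Proof.
elim: s => [|z s [t tP]]; first by exists [::].
have [[z' z'z]|nz] := pselect (exists z' : submod_type (Mn n), val z' = z).
  have [s' [s'P _]] := phiP z'.
  exists ([seq val i | i <- s'] ++ t) => x.
  rewrite inE => /predU1P[xz|/tP tx] i ix; rewrite mem_cat; last by rewrite tx ?orbT.
  rewrite map_f //; apply: contraNT ix => /s'P; rewrite -z'z in xz.
  by rewrite (val_inj xz) => ->.
exists t => x; rewrite inE => /predU1P[xz|/tP //].
by exfalso; apply: nz; exists x.
Qed.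

(** Every element lies in some [Mn n], where its coordinates take values in a domain. *)
Lemma chain_torsion_free (r : R) (x : M) : r != 0 -> r *: x = 0 -> x = 0.
Proof.
move=> r0 rx; have [n Mx] := Mn_cover x; have [y yx] := in_submod_type Mx.
rewrite -yx in rx *; apply: (support_in (S := [set 0])).
  by split=> // a _ _ -> ->; rewrite scaler0 addr0.
have ry : r *: y = 0 by apply: val_inj; rewrite linearZ /= rx.
move=> i; have /eqP : phi i (r *: y) = 0 by rewrite ry phi0.
by rewrite phiZ mulf_eq0 (negPf r0) /= => ->.
Qed.

(** By purity r x = r y with y in [Mn n], and x = y because [M] is torsion-free. *)
Let Mn_tf n : rel_torsion_free setT (Mn n).
Proof.
move=> r x r0 _ /(pure_divisible (@Mn_pure n))[y My ryx].
suff : x - y = 0 by move/eqP; rewrite subr_eq0 => /eqP ->.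
by apply: (chain_torsion_free r0); rewrite scalerBr ryx subrr.
Qed.

Definition to_rel n (x : submod_type (Mn n.+1)) : relfactor (Mn n.+1) (Mn n) :=
  to_factor (trace (Mn n.+1) (Mn n)) x.

Fact to_rel_linear n : linear (@to_rel n).
Proof. by move=> a x y; exact: to_factor_linear. Qed.

Lemma to_relP n (x y : submod_type (Mn n.+1)) :
  to_rel x = to_rel y <-> submod_set (Mn n) (val x - val y).
Proof.
have -> : val x - val y = val (x - y) by rewrite linearB.
by rewrite /to_rel to_factorP inE.
Qed.

Definition img n (A : set M) : set (relfactor (Mn n.+1) (Mn n)) :=
  (@to_rel n) @` (val @^-1` A).

Arguments img : clear implicits.

Lemma in_img n A (x : submod_type (Mn n.+1)) : A (val x) -> img n A (to_rel x).
Proof. by exists x. Qed.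

Lemma to_rel0 n : @to_rel n 0 = 0.
Proof. exact: (linear0 (linear_of (@to_rel_linear n))). Qed.

Lemma to_relZ n a x : @to_rel n (a *: x) = a *: to_rel x.
Proof. exact: (linearZ_LR (linear_of (@to_rel_linear n))). Qed.

Lemma submod_img n A : submod A -> submod (img n A).
Proof.
move=> sA; split=> [|a _ _ [x Ax <-] [y Ay <-]].
  by rewrite -to_rel0; apply: in_img; rewrite linear0; exact: submod0.
rewrite -to_rel_linear; apply: in_img.
by rewrite linearP; case: sA => _; apply.
Qed.

Lemma img_bigcup n I (D : set I) (F : I -> set M) :
  img n (\bigcup_(i in D) F i) = \bigcup_(i in D) img n (F i).
Proof.
apply/seteqP; split=> [_ [x [i Di Fx] <-]|_ [i Di [x Fx <-]]].
  by exists i => //; exists x.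
by exists x => //; exists i.
Qed.

Definition good (A : set M) : Prop :=
  [/\ submod A,
      forall n (x i : submod_type (Mn n)), A (val x) -> phi i x != 0 -> A (val i) &
      forall n, exists2 C : submodule (relfactor (Mn n.+1) (Mn n)),
        fam C & C = img n A :> set _].

Lemma good0 : good [set 0].
Proof.
split.
- by split=> // a _ _ -> ->; rewrite scaler0 addr0.
- move=> n x i /= x0; rewrite (_ : x = 0) ?phi0 ?eqxx //.
  by apply: val_inj; rewrite [RHS]linear0; exact: x0.
move=> n; have [[[C CC C0] _] _ _] := @famG n; exists C => //.
rewrite C0; apply/seteqP; split=> [_ ->|_ [x /= x0 <-]].
  by rewrite -to_rel0; apply: in_img; rewrite linear0.
have -> : x = 0 by apply: val_inj; rewrite [RHS]linear0; exact: x0.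
exact: to_rel0.
Qed.

Lemma good_bigcup (F : set (set M)) : F `<=` good -> F !=set0 ->
  total_on F subset -> good (\bigcup_(A in F) A).
Proof.
move=> Fgood F0 Ftot; split.
- by apply: submod_bigcup_total => // A /Fgood[].
- move=> n x i [A FA Ax] xi; exists A => //.
  by have [_ sA _] := Fgood _ FA; exact: sA Ax xi.
move=> n; have [|||U FU eU] := @G_family_chain _ _ _ (img n @` F) (@famG n).
- by move=> _ [A /Fgood[_ _ /(_ n)[C ? ?]] <-]; exists C.
- by have [A FA] := F0; exists (img n A); exists A.
- move=> _ _ [A FA <-] [A' FA' <-].
  by have [s|s] := Ftot _ _ FA FA'; [left|right]; apply: image_subset => x; exact: s.
by exists U => //; rewrite eU img_bigcup bigcup_image.
Qed.

(** Induction on the stage containing x. Modulo [Mn N], r x is the image of an element of [A];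
    purity of the image of [A] yields b in [A] with x - b in [Mn N], to which the induction
    hypothesis applies. *)
Lemma good_sum_torsion_free A m : good A ->
  rel_torsion_free setT (span (A `|` Mn m)).
Proof.
move=> [sA _ imgA] r x r0 _; have [N MNx] := Mn_cover x.
set S := span _; have sS : submod S := submod_span _.
have AS : A `<=` S by move=> y Ay; apply: sub_span; left.
elim: N x MNx => [|N IH] x MNx Srx.
  by move: MNx; rewrite Mn0 => ->; exact: submod0.
have [Nm|/ltnSE mN] := ltnP N m.
  by apply: sub_span; right; exact: Mn_mono MNx.
have [a Aa] : exists2 a, A a & submod_set (Mn m) (r *: x - a).
  by have /(span_addP _ _ sA)[a Aa] := Srx; rewrite span_id //; exists a.
move=> /(Mn_mono mN) Ma.
have [x' x'x] := in_submod_type MNx.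
have MNa : submod_set (Mn N.+1) a.
  rewrite -[a](subKr (r *: x)); apply: submodB => //.
    exact: submodZ.
  exact: MnS.
have [a' a'a] := in_submod_type MNa.
have [C CC eC] := imgA N.
have rx'a' : r *: to_rel x' = to_rel a'.
  by rewrite -to_relZ; apply/to_relP; rewrite linearZ /= x'x a'a.
have [|v] := pure_divisible (r := r) (x := to_rel x') (fam_pure CC).
  by rewrite rx'a' eC; exists a'; rewrite //= a'a.
rewrite eC => -[b Ab <-] rbx.
have Mxb : submod_set (Mn N) (x - val b).
  apply: (Mn_tf r0) => //; rewrite scalerBr -x'x.
  have : to_rel (r *: x') = to_rel (r *: b) by rewrite !to_relZ rbx.
  by move=> /to_relP; rewrite !linearZ.
rewrite -(subrK (val b) x); apply: (submodD sS); last exact: AS.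
apply: IH => //; rewrite scalerBr; apply: (submodB sS) => //.
exact: (submodZ _ sS (AS _ Ab)).
Qed.

Lemma good_torsion_free A : good A -> rel_torsion_free setT A.
Proof.
move=> gA; have [sA _ _] := gA.
have /(_ 0%N) := @good_sum_torsion_free A ^~ gA.
rewrite Mn0 (_ : A `|` _ = A) ?span_id //.
by apply/seteqP; split=> x; [case=> // ->; exact: submod0|left].
Qed.

(** If [s] lies in [Mn n], so does the torsion closure [K] modulo [A]. An element and its nonzero
    multiples have the same support, so [K] lies in the span of [A] and of a finite set [t]
    supporting [s]. That span has torsion-free quotient by [K], which is therefore a retract of
    it. *)
Lemma good_torsion_closure_fg A (s : seq M) : good A ->
  exists t : seq M, torsion_closure (A `|` [set` s]) = span (A `|` [set` t]).
Proof.
move=> gA; have [sA suppA _] := gA.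
have [n sMn'] : exists n, [set` s] `<=` Mn n.
  elim: (s) => [|x u [n uMn]]; first by exists 0%N.
  have [m Mx] := Mn_cover x; exists (maxn m n) => y.
  rewrite /= inE => /predU1P[->|uy]; first by apply: Mn_mono Mx; rewrite leq_maxl.
  by apply: (Mn_mono (leq_maxr m n)); exact: uMn.
have [t tP] := finite_support s n.
set K := torsion_closure _; have sK : submod K := submod_torsion_closure _.
have AK : A `<=` K.
  by move=> x Ax; apply: sub_torsion_closure; apply: sub_span; left.
have supp (z : submod_type (Mn n)) : span (A `|` [set` s]) (val z) ->
    forall i, phi i z != 0 -> (A `|` [set` t]) (val i).
  move=> /(span_addP _ _ sA)[a Aa sza]; apply: supportedP.
  (* The part in the span of [s] has support in [t]; hence a also lies in [Mn n], and its support is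
     in [A]. *)
  rewrite -(subrK a (val z)) addrC.
  have : supported n (A `|` [set` t]) (val z - a).
    apply: span_min sza => [|x sx]; first exact: submod_supported.
    have [x' x'x] := in_submod_type (sMn' _ sx).
    exists x'; split=> // i ix; right; apply: tP ix; rewrite x'x; exact: sx.
  move=> sup; apply: submodD => //; first exact: submod_supported.
  have [w [wza _]] := sup.
  exists (z - w); split=> [|i]; first by rewrite linearB /= wza subKr.
  by move=> iz; left; apply: suppA iz; rewrite linearB /= wza subKr.
have KB : K `<=` span (A `|` [set` t]).
  move=> x Kx; have [r r0 Sx] := Kx.
  have [a Aa Mxa] : exists2 a, A a & submod_set (Mn n) (x - a).
    have /(span_addP _ _ sA)[a Aa] : span (A `|` Mn n) x.
      apply: (good_sum_torsion_free gA r0) => //.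
      by apply: span_mono Sx; apply: setUS.
    by rewrite span_id //; exists a.
  have [y yxa] := in_submod_type Mxa.
  rewrite -(subrK a x) -yxa; apply: (submodD (submod_span _)); last first.
    by apply: sub_span; left.
  apply: support_in => [|i iy]; first exact: submod_span.
  apply: sub_span; apply: (supp (r *: y)).
    rewrite linearZ /= yxa scalerBr; apply: (submodB (submod_span _)) => //.
    by apply: sub_span; left; exact: submodZ.
  by rewrite phiZ mulf_neq0.
apply: (lin_ext_fg (s := t)) => //.
have eB : span (A `|` [set` t]) = span (K `|` [set` t]).
  apply/seteqP; split; first by apply: span_mono; exact: setSU.
  apply: span_min => [|x [/KB//|tx]]; first exact: submod_span.
  by apply: sub_span; right.
rewrite eB; apply: fg_torsion_free_lin_ext => // r x r0 _.
exact: (torsion_closure_torsion_free r0).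
Qed.

(** The trace [L] of A + [Mn m] on the torsion closure [K] has torsion-free quotient K / L, so it is
    a retract of [K] and finitely generated over [A]; its generators are then moved into [Mn m]. *)
Lemma good_trace_fg A (s : seq M) m : good A ->
  exists t : seq M, (forall x, x \in t -> submod_set (Mn m) x) /\
    forall x, span (A `|` [set` s]) x -> submod_set (Mn m) x ->
      span (A `|` [set` t]) x.
Proof.
move=> gA; have [sA _ _] := gA.
have [t eK] := good_torsion_closure_fg s gA.
set K := torsion_closure _ in eK.
have sK : submod K := submod_torsion_closure _.
have AK : A `<=` K.
  by move=> x Ax; apply: sub_torsion_closure; apply: sub_span; left.
pose L := K `&` span (A `|` Mn m).
have sL : submod L by apply: submodI => //; exact: submod_span.
have AL : A `<=` L by move=> x Ax; split; [exact: AK|apply: sub_span; left].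
have eLK : K = span (L `|` [set` t]).
  apply/seteqP; split; first by rewrite eK; apply: span_mono; exact: setSU.
  apply: span_min => // x [[]//|tx].
  by rewrite eK; apply: sub_span; right.
have [u eL] : exists u : seq M, L = span (A `|` [set` u]).
  apply: (lin_ext_fg (s := t)) => //; rewrite -eK; first by move=> x [].
  rewrite eLK; apply: fg_torsion_free_lin_ext => // r x r0.
  rewrite -eLK => Kx [_ Sx]; split=> //.
  exact: (good_sum_torsion_free gA r0).
have [|v vM uv] := @span_representatives _ _ A (Mn m) u sA (sMn m).
  move=> x ux; suff [_] : L x by [].
  by rewrite eL; apply: sub_span; right.
exists v; split=> // x Sx Mx; apply: uv; rewrite -eL; split.
  exact: sub_torsion_closure.
by apply: sub_span; right.
Qed.

(** * Enlarging a good submodule *)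

Section Enlarge.
Context (A : set M) (gA : good A).

Let sA : submod A. Proof. by case: gA. Qed.

(** This condition allows the two others to be checked on the elements of [A] and [H] alone. *)
Let trace_generated n : set (set M) :=
  [set H | forall x, span (A `|` H) x -> submod_set (Mn n) x ->
     span ((A `|` H) `&` Mn n) x].

Let support_closed n : set (set M) :=
  [set H | forall x i : submod_type (Mn n),
     H (val x) -> phi i x != 0 -> H (val i)].

Let image_in_family n : set (set M) :=
  [set H | exists2 C : submodule (relfactor (Mn n.+1) (Mn n)),
     fam C & C = img n (span ((A `|` H) `&` Mn n.+1)) :> set _].

(** A single enlargement suffices: the adjoined elements lie in [Mn n], so subtracting their
    combinations reduces the trace to that of the original [H]. *)
Let club_trace_generated n : club (trace_generated n).
Proof.
split=> [H cH|H Hinc HP x]; last first.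
  rewrite setU_bigcup_nat span_bigcup; last by move=> k; exact/setUS/Hinc.
  have Hmono := nondecreasing_subset Hinc.
  move=> [k _ Sx] Mx; have [k' kk' HP'] := HP k.
  have : span (A `|` H k') x.
    by move: Sx; apply: span_mono; apply: setUS; exact: Hmono.
  move=> /HP'/(_ Mx); apply: span_mono; apply: setSI.
  by move=> y Hy; exists k'.
have [E [Einc eH]] := countable_bigcup_seq cH.
have /choice[t tP] := fun k => good_trace_fg (E k) n gA.
have cT : countable (\bigcup_k [set` t k]).
  by apply: bigcup_countable => // k _; apply: finite_set_countable.
exists (H `|` \bigcup_k [set` t k]); split.
- by rewrite -bigcup2E; apply: bigcup_countable => // -[|[|i]].
- by move=> x; left.
move=> x; set T := \bigcup_k _ in cT *.
have TM : T `<=` Mn n by move=> y [k _] /(tP k).1.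
rewrite setUA => Sx Mx.
have [y Sy STxy] : exists2 y, span (A `|` H) y & span T (x - y).
  apply/(span_addP _ _ (submod_span _)).
  by move: Sx; apply: span_mono; apply: setSU; exact: sub_span.
have My : submod_set (Mn n) y.
  by rewrite -[y](subKr x); apply: submodB => //; exact: (span_min (sMn n) TM).
rewrite -(subrK y x); apply: (submodD (submod_span _)).
  by move: STxy; apply: span_mono => z Tz; split; [right|exact: TM].
have [k Sty] : exists k, span (A `|` [set` t k]) y.
  move: Sy; rewrite eH setU_bigcup_nat span_bigcup; last by move=> k; exact: setUS.
  by move=> [k _ /(tP k).2/(_ My)]; exists k.
have := span_capture sA (sMn n) (tP k).1 Sty My.
apply: span_mono; apply: setSI => z [Az|tz]; first by left; left.
by right; exists k.
Qed.

(** Each element has finite support, so adjoining supports countably many times keeps the set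
    countable. *)
Let club_support_closed n : club (support_closed n).
Proof.
split=> [H cH|H Hinc HP x i [k _ Hx] ix]; last first.
  have Hmono := nondecreasing_subset Hinc.
  have [k' kk' HP'] := HP k; exists k' => //.
  by apply: HP' ix; exact: Hmono Hx.
have /choice[t tP] := fun x => finite_support [:: x] n.
pose fix Hs k := if k is k'.+1 then Hs k' `|` \bigcup_(x in Hs k') [set` t x] else H.
have cHs k : countable (Hs k).
  elim: k => //= k IH; rewrite -bigcup2E; apply: bigcup_countable => // -[|[|i]] _ //=.
  by apply: bigcup_countable => // x _; apply: finite_set_countable.
exists (\bigcup_k Hs k); split.
- exact: bigcup_countable.
- by move=> x Hx; exists 0%N.
move=> x i [k _ Hx] ix; exists k.+1 => //; right; exists (val x) => //.
by apply: tP ix; exact: mem_head.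
Qed.

(** The countable extension property, applied to the images of [A] and [H], yields [C];
    representatives of its generators over the image of [A] are adjoined to [H]. *)
Let club_image_in_family n : club (image_in_family n).
Proof.
split=> [H cH|H Hinc HP].
  have [_ _ /(_ n)[C0 C0fam eC0]] := gA.
  (* Elements outside [Mn n.+1] are sent to 0, which is harmless as only those inside are compared
     with [C]. *)
  pose h x : relfactor (Mn n.+1) (Mn n) :=
    to_rel (insubd (0 : submod_type (Mn n.+1)) x).
  have cHb : countable (h @` H) := sub_countable (card_image_le _ _) cH.
  have [_ _ /(_ C0 _ C0fam cHb)[C [Cfam C0C HC]]] := @famG n.
  move=> /relfactor_generators[S [cS SC CS]].
  have /choice[rep repP] (u : relfactor (Mn n.+1) (Mn n)) :
      exists x : submod_type (Mn n.+1), to_rel x = u.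
    exists (repr (u : Quotient.quot (submod_pred (trace (Mn n.+1) (Mn n))))).
    exact: factor_reprK.
  pose G := (fun u => val (rep u)) @` S.
  have cG : countable G := sub_countable (card_image_le _ _) cS.
  exists (H `|` G); split.
  - by rewrite -bigcup2E; apply: bigcup_countable => // -[|[|i]].
  - by move=> x; left.
  exists C => //; apply/seteqP; split.
    move=> u /CS; apply: span_min; first exact/submod_img/submod_span.
    move=> v [|Sv].
      rewrite eC0 => -[x Ax <-]; apply: in_img; apply: sub_span.
      by split; [left|exact: submod_type_in].
    rewrite -(repP v); apply: in_img; apply: sub_span.
    by split; [right; right; exists v|exact: submod_type_in].
  have sC := submod_submodule C.
  pose D := [set w | exists w' : submod_type (Mn n.+1),
    val w' = w /\ submod_set C (to_rel w')].
  have sD : submod D.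
    split=> [|a _ _ [x [<- Cx]] [y [<- Cy]]].
      exists 0; split; first by rewrite linear0.
      by rewrite to_rel0; exact: submod0.
    exists (a *: x + y); split; first by rewrite linearP.
    by rewrite to_rel_linear; case: sC => _; apply.
  move=> _ [x Sx <-].
  suff [w [/val_inj -> //]] : D (val x).
  move: Sx; apply: span_min => // w [AHw /in_submod_type[w' w'w]].
  exists w'; split=> //; case: AHw => [Aw|[Hw|[u Su uw]]].
  - by apply: C0C; rewrite eC0; apply: in_img; rewrite w'w.
  - by apply: HC; exists w => //; rewrite /h -w'w valKd.
  - have -> : w' = rep u by apply: val_inj; rewrite w'w.
    by rewrite repP; exact: SC.
have Hmono := nondecreasing_subset Hinc.
pose Sp k := span ((A `|` H k) `&` Mn n.+1).
have Spmono i j : (i <= j)%N -> Sp i `<=` Sp j.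
  by move=> ij; apply: span_mono; apply: setSI; apply: setUS; exact: Hmono.
(* Only the stages satisfying the condition enter the chain; being cofinal, they have the same
   union. *)
pose F := (fun k => img n (Sp k)) @` [set k | image_in_family n (H k)].
have [|||U FU eU] := @G_family_chain _ _ _ F (@famG n).
- by move=> _ [k [C CC eC] <-]; exists C.
- by have [k _ Hk] := HP 0%N; exists (img n (Sp k)); exists k.
- move=> _ _ [i _ <-] [j _ <-].
  by have [ij|/ltnW ij] := leqP i j; [left|right]; apply: image_subset => x; exact: Spmono.
exists U => //; rewrite eU bigcup_image -img_bigcup; congr (img n _).
rewrite setU_bigcup_nat setI_bigcupl span_bigcup; last first.
  by move=> k; apply: setSI; apply: setUS; exact: Hinc.
apply/seteqP; split=> [x [k _ Sx]|x [k _ Sx]]; first by exists k.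
by have [k' kk' Hk'] := HP k; exists k' => //; exact: Spmono Sx.
Qed.

Lemma good_enlarge : A <> setT ->
  exists A', [/\ good A', A `<=` A', A' <> A & lin_ext A A'].
Proof.
move=> AnT; have [z nAz] : exists z, ~ A z.
  apply: contrapT => nz; apply: AnT; apply/seteqP; split=> // x _.
  by apply: contrapT => nAx; apply: nz; exists x.
(* One countable set containing z meets all three conditions for every n. *)
have [H [cH zH [HP1 [HP2 HP3]]]] := (club_and (club_forall club_trace_generated)
  (club_and (club_forall club_support_closed) (club_forall club_image_in_family))).1
  [set z] (countable1 z).
pose A' := span (A `|` H).
have AA' : A `<=` A' by move=> x Ax; apply: sub_span; left.
have sA' : submod A' := submod_span _.
have gA' : good A'.
  split=> // [n x i A'x ix|n].
    suff : supported n A' (val x) by move=> /supportedP; apply.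
    have := HP1 n _ A'x (submod_type_in x).
    apply: span_min => [|w [AHw /in_submod_type[w' w'w]]].
      exact: submod_supported.
    exists w'; split=> // j jw; apply: sub_span; case: AHw => [Aw|Hw].
      by left; have [_ sup _] := gA; apply: sup jw; rewrite w'w.
    by right; apply: HP2 jw; rewrite w'w.
  have [C CC eC] := HP3 n; exists C => //; rewrite eC.
  apply/seteqP; split=> [_ [x Sx <-]|_ [x A'x <-]]; apply: in_img.
    by move: Sx; apply: span_mono => w [].
  exact: HP1 A'x (submod_type_in x).
exists A'; split=> //.
  by move=> eA; apply: nAz; rewrite -eA; apply: sub_span; right; exact: zH.
have [E [Einc eH]] := countable_bigcup_seq cH.
(* These closures exhaust [A'] and are finitely generated over [A], so each step of the chain is
   finitely generated and torsion-free. *)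
pose F k := torsion_closure (A `|` [set` E k]).
have sF k : submod (F k) := submod_torsion_closure _.
have Finc k : F k `<=` F k.+1 by apply: torsion_closure_mono; exact: setUS.
have Fext (B : set M) k : submod B -> A `<=` B -> B `<=` F k ->
    rel_torsion_free (F k) B -> lin_ext B (F k).
  move=> sB AB BF tB; have [t eF] := good_torsion_closure_fg (E k) gA.
  have eB : F k = span (B `|` [set` t]).
    apply/seteqP; split; first by rewrite [F k]eF; apply: span_mono; exact: setSU.
    apply: span_min => // x [/BF //|tx].
    by rewrite [F k]eF; apply: sub_span; right.
  by rewrite eB; apply: fg_torsion_free_lin_ext => //; rewrite -eB.
have AF k : A `<=` F k.
  by move=> x Ax; apply: sub_torsion_closure; apply: sub_span; left.
have eA' : A' = \bigcup_k F k.
  apply/seteqP; split.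
    rewrite /A' eH setU_bigcup_nat span_bigcup; last by move=> k; exact: setUS.
    by move=> x [k _ Sx]; exists k => //; exact: sub_torsion_closure.
  (* [A'] contains the closures because it is good, so that M / A' is torsion-free. *)
  move=> x [k _]; apply: torsion_closure_min => //; first exact: good_torsion_free.
  move=> y [/AA' //|Ey]; apply: sub_span; right; rewrite eH.
  by exists k.
rewrite eA'; apply: (lin_ext_trans (AF 0%N)).
  by apply: Fext => // r x r0 _; exact: (good_torsion_free gA r0).
apply: lin_ext_bigcup => // k; apply: Fext => // r x r0 _.
exact: (torsion_closure_torsion_free r0).
Qed.

End Enlarge.

Lemma pure_chain_projective : projective M.
Proof.
apply: (lin_ext_projective (B := good)).
- by move=> A [].
- exact: good0.
- exact: good_bigcup.
- by move=> A; exact: good_enlarge.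
Qed.

End PureChain.

Theorem theorem13 (R : idomainType) (M : lmodType R) (Mn : nat -> submodule M)
  (hR : prufer_domain R)
  (hM0 : Mn 0%N = [set 0] :> set M)
  (hchain : forall n : nat, Mn n `<=` Mn n.+1)
  (hproj : forall n : nat, projective (submod_type (Mn n)))
  (hpure : forall n : nat, pure (Mn n))
  (hfam : forall n : nat,
     exists2 C : set (submodule (relfactor (Mn n.+1) (Mn n))),
       G_aleph0_family C & forall A, C A -> pure A)
  (hunion : \bigcup_n Mn n = [set: M]) :
  projective M.
Proof.
(* A dual basis and a family are chosen simultaneously for all n. *)
pose phi n := sval (cid (dual_basis (hproj n))).
have phiP n := svalP (cid (dual_basis (hproj n))).
pose fam n := s2val (cid2 (hfam n)).
apply: (@pure_chain_projective R M Mn hR hM0 hchain hunion hpure phi _ _ fam).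
- by move=> n; exact: (phiP n).1.
- by move=> n; exact: (phiP n).2.
- by move=> n; exact: (s2valP (cid2 (hfam n))).
- by move=> n; exact: (s2valP' (cid2 (hfam n))).
Qed.
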